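(* Let $B$ be a skew brace of nilpotent type. Then the following properties are equivalent: (1) $B$ is annihilator nilpotent; (2) $B$ is left nilpotent and right nilpotent; (3) $B$ is strongly nilpotent.
   Context: A skew brace is a triple $(B,+,\circ)$ where $(B,+)$ and $(B,\circ)$ are (not necessarily abelian) groups such that $a\circ(b+c)=a\circ b-a+a\circ c$ for all $a,b,c\in B$. The two groups share the same identity, denoted $0$. It is of nilpotent type if $(B,+)$ is a nilpotent group. Put $\lambda_a(b)=-a+a\circ b$ and $a*b=-a+a\circ b-b$. An ideal of $B$ is a subset that is a normal subgroup of both $(B,+)$ and $(B,\circ)$ and is mapped into itself by every $\lambda_a$. The annihilator is $\operatorname{Ann}(B)=\{x\in B: x\circ a=a\circ x=x+a=a+x \text{ for all } a\in B\}$, an ideal of $B$. An annihilator series of $B$ is a series of ideals $0=I_0\subseteq I_1\subseteq\cdots\subseteq I_n=B$ with $I_{j+1}/I_j\subseteq\operatorname{Ann}(B/I_j)$ for $0\le j<n$; $B$ is annihilator nilpotent if it has an annihilator series. For subsets $X,Y\subseteq B$, $X*Y$ denotes the additive subgroup generated by $\{x*y:x\in X,\ y\in Y\}$. Put $B^1=B$, $B^{n+1}=B*B^n$; $B$ is left nilpotent if $B^n=0$ for some positive integer $n$. Put $B^{(1)}=B$, $B^{(n+1)}=B^{(n)}*B$; $B$ is right nilpotent if $B^{(n)}=0$ for some positive integer $n$. Put $B^{[1]}=B$ and let $B^{[n+1]}$ be the additive subgroup generated by $\bigcup_{i=1}^{n}B^{[i]}*B^{[n+1-i]}$; $B$ is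 strongly nilpotent if $B^{[n]}=0$ for some positive integer $n$. *)

(* Defs.v *)
From HB Require Import structures.
From mathcomp Require Import all_boot.
From mathcomp Require Import boolp classical_sets.

Set Implicit Arguments.
Unset Strict Implicit.
Unset Printing Implicit Defensive.

Declare Scope skew_scope.
Delimit Scope skew_scope with skew.
Local Open Scope classical_set_scope.
Local Open Scope quotient_scope.
Local Open Scope skew_scope.

Reserved Notation "a ∘ b" (at level 40, left associativity).

Section Groups.
Local Open Scope group_scope.
Variable G : groupType.
Implicit Types H X : set G.

Definition subgroup H : Prop :=
  [/\ H 1, (forall x y, H x -> H y -> H (x * y)) & forall x, H x -> H x^-1].

Definition normal_subgroup H : Prop :=
  subgroup H /\ forall x g, H x -> H (x ^ g).

Definition generated X : set G := smallest subgroup X.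

(* The index is shifted: [lower_central 0] is the whole group. *)
Fixpoint lower_central (n : nat) : set G :=
  if n is m.+1
  then generated [set [~ x, y] | x in lower_central m & y in setT]
  else setT.

Definition nilpotent_group : Prop := exists n, lower_central n = [set 1].

End Groups.

(* The group (B, ∘) is the [groupType] structure of B. The group (B, +) need
   not be abelian, so it cannot be given by a [zmodType] structure. *)
HB.mixin Record Group_isSkewBrace B of Group B := {
  sbadd : B -> B -> B;
  sbzero : B;
  sbopp : B -> B;
  sbaddA : associative sbadd;
  sbadd0 : left_id sbzero sbadd;
  sbaddr0 : right_id sbzero sbadd;
  sbaddN : left_inverse sbzero sbopp sbadd;
  sbaddrN : right_inverse sbzero sbopp sbadd;
  sbmulD : forall a b c : B,
    mul a (sbadd b c) = sbadd (sbadd (mul a b) (sbopp a)) (mul a c)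
}.

#[short(type="skewBraceType")]
HB.structure Definition SkewBrace := {B of Group B & Group_isSkewBrace B}.

Bind Scope skew_scope with SkewBrace.sort.
Notation "a ∘ b" := (@mul _ a b) : skew_scope.
Notation "a + b" := (@sbadd _ a b) : skew_scope.
Notation "- a" := (@sbopp _ a) : skew_scope.
Notation "a - b" := (@sbadd _ a (@sbopp _ b)) : skew_scope.
Notation "0" := (@sbzero _) : skew_scope.

(* Alias of B whose [groupType] structure is (B, +). *)
Definition addgroup (B : Type) : Type := B.

HB.instance Definition _ (B : skewBraceType) := Choice.copy (addgroup B) B.
HB.instance Definition _ (B : skewBraceType) := isGroup.Build (addgroup B)
  (@sbaddA B) (@sbadd0 B) (@sbaddr0 B) (@sbaddN B) (@sbaddrN B).

Section SkewBraceDefs.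
Variable B : skewBraceType.
Implicit Types (a b : B) (I X Y : set B).

Definition nilpotent_type : Prop := nilpotent_group (addgroup B).

Definition lambda a b : B := - a + a ∘ b.

Definition star a b : B := - a + a ∘ b - b.

Definition is_ideal I : Prop :=
  [/\ normal_subgroup (I : set (addgroup B)), normal_subgroup I
    & forall a x, I x -> I (lambda a x)].

Definition annihilator : set B :=
  [set x | forall a, [/\ x ∘ a = a ∘ x, a ∘ x = x + a & x + a = a + x]].

Definition star_set X Y : set B :=
  generated ([set star x y | x in X & y in Y] : set (addgroup B)).

(* The three series below start at index 0, whereas the usual indexing starts
   at 1: [left_series n] is B^{n+1}, [right_series n] is B^{(n+1)} and
   [strong_series n] is B^{[n+1]}. *)
Fixpoint left_series (n : nat) : set B :=
  if n is m.+1 then star_set setT (left_series m) else setT.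

Fixpoint right_series (n : nat) : set B :=
  if n is m.+1 then star_set (right_series m) setT else setT.

Definition strong_step (s : seq (set B)) : set B :=
  generated (\bigcup_(i in `I_(size s))
    star_set (nth set0 s i) (nth set0 s ((size s).-1 - i))
    : set (addgroup B)).

(* The first n+1 terms of [strong_series], each one computed from the list of
   all the previous ones; see [strong_series0] and [strong_seriesS]. *)
Fixpoint strong_terms (n : nat) : seq (set B) :=
  if n is m.+1 then rcons (strong_terms m) (strong_step (strong_terms m))
  else [:: setT].

Definition strong_series (n : nat) : set B := nth set0 (strong_terms n) n.

Definition left_nilpotent : Prop := exists n, left_series n = [set 0].

Definition right_nilpotent : Prop := exists n, right_series n = [set 0].

Definition strongly_nilpotent : Prop := exists n, strong_series n = [set 0].

Lemma size_strong_terms n : size (strong_terms n) = n.+1.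
Proof. by elim: n => //= n IHn; rewrite size_rcons IHn. Qed.

Lemma nth_strong_terms n i :
  (i <= n)%N -> nth set0 (strong_terms n) i = strong_series i.
Proof.
elim: n => [|n IHn]; first by rewrite leqn0 => /eqP->.
rewrite leq_eqVlt => /predU1P[->//|lein].
by rewrite /= nth_rcons size_strong_terms lein IHn.
Qed.

Lemma strong_series0 : strong_series 0 = setT.
Proof. by []. Qed.

Lemma strong_seriesS n :
  strong_series n.+1 =
  generated (\bigcup_(i in `I_n.+1)
    star_set (strong_series i) (strong_series (n - i)) : set (addgroup B)).
Proof.
rewrite /strong_series /= nth_rcons size_strong_terms ltnn eqxx.
rewrite /strong_step size_strong_terms /=; congr (@generated (addgroup B) _).
apply: eq_bigcupr => i /=; rewrite ltnS => lein.
by rewrite !nth_strong_terms ?leq_subr.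
Qed.

End SkewBraceDefs.

Arguments annihilator : clear implicits.
Arguments left_series : clear implicits.
Arguments right_series : clear implicits.
Arguments strong_series : clear implicits.

Record ideal (B : skewBraceType) :=
  Ideal { ideal_set :> set B; idealP : is_ideal ideal_set }.

Section Quotient.
Variables (B : skewBraceType) (J : ideal B).
Local Notation I := (ideal_set J).
Implicit Types a b x y : B.

Lemma sbaddNK a b : a + (- a + b) = b.
Proof. by rewrite sbaddA sbaddrN sbadd0. Qed.

Lemma sb10 : 1%g = 0 :> B.
Proof.
have := sbmulD (1%g : B) 0 0; rewrite sbadd0 !mul1g sbadd0 sbaddr0 => h.
by rewrite -[LHS]sbaddr0 h sbaddrN.
Qed.

Lemma lambda_invl a b : a^-1%g ∘ (a + b) = lambda a^-1%g b.
Proof. by rewrite sbmulD mulVg sb10 sbadd0. Qed.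

Lemma ideal_add0 : I 0.
Proof. by have [[[]]] := idealP J. Qed.

Lemma ideal_addD x y : I x -> I y -> I (x + y).
Proof. by have [[[_ + _] _] _ _] := idealP J; apply. Qed.

Lemma ideal_addN x : I x -> I (- x).
Proof. by have [[[_ _ +] _] _ _] := idealP J; apply. Qed.

Lemma ideal_addJ x a : I x -> I (- a + (x + a)).
Proof. by have [[_ +] _ _] := idealP J; apply. Qed.

Lemma ideal_mulM x y : I x -> I y -> I (x ∘ y).
Proof. by have [_ [[_ + _] _] _] := idealP J; apply. Qed.

Lemma ideal_mulV x : I x -> I x^-1%g.
Proof. by have [_ [[_ _ +] _] _] := idealP J; apply. Qed.

Lemma ideal_mulJ x a : I x -> I (a^-1%g ∘ (x ∘ a)).
Proof. by have [_ [_ +] _] := idealP J; apply. Qed.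

Lemma ideal_lambda a x : I x -> I (lambda a x).
Proof. by have [_ _ +] := idealP J; apply. Qed.

Definition ideal_eq : rel B := fun x y => `[< I (- x + y) >].

Lemma sboppD x y : - (x + y) = - y - x.
Proof. exact: (@invgM (addgroup B)). Qed.

Lemma sboppK x : - - x = x.
Proof. exact: (@invgK (addgroup B)). Qed.

Lemma ideal_eq_refl : reflexive ideal_eq.
Proof. by move=> x; apply/asboolP; rewrite sbaddN; exact: ideal_add0. Qed.

Lemma ideal_eq_sym : symmetric ideal_eq.
Proof.
move=> x y; apply/asboolP/asboolP => /ideal_addN;
by rewrite sboppD sboppK.
Qed.

Lemma ideal_eq_trans : transitive ideal_eq.
Proof.
move=> y x z /asboolP xy /asboolP yz; apply/asboolP.
by have := ideal_addD xy yz; rewrite -sbaddA sbaddNK.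
Qed.

Canonical ideal_equiv :=
  EquivRel ideal_eq ideal_eq_refl ideal_eq_sym ideal_eq_trans.

(* Additive and multiplicative cosets of an ideal coincide. *)
Lemma ideal_eqM x y : ideal_eq x y <-> I (x^-1%g ∘ y).
Proof.
split=> [/asboolP xy|xy].
  by rewrite -(sbaddNK x y) lambda_invl; exact: ideal_lambda.
apply/asboolP; have -> : - x + y = lambda x (x^-1%g ∘ y).
  by rewrite /lambda mulgA mulgV mul1g.
exact: ideal_lambda.
Qed.

(* The quotient skew brace B/I, of carrier the set of cosets of I. *)
Definition quot := {eq_quot ideal_equiv}.

HB.instance Definition _ := Choice.on quot.
HB.instance Definition _ := EqQuotient.on quot.

Definition quot_add := lift_op2 quot (@sbadd B).
Definition quot_opp := lift_op1 quot (@sbopp B).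
Definition quot_zero := \pi_quot (0 : B).
Definition quot_mul := lift_op2 quot (@mul B).
Definition quot_inv := lift_op1 quot (@inv B).

Lemma quot_eqP x y : \pi_quot x = \pi_quot y <-> I (- x + y).
Proof.
by split=> [/eqP|/asboolP h]; [|apply/eqP]; rewrite eqmodE // => /asboolP.
Qed.

Lemma quot_repr x : I (- x + repr (\pi_quot x)).
Proof. by apply/quot_eqP; rewrite reprK. Qed.

Lemma pi_quot_add : {morph \pi_quot : x y / x + y >-> quot_add x y}.
Proof.
move=> x y; unlock quot_add; apply/quot_eqP.
set x' := repr _; set y' := repr _.
have -> : - (x + y) + (x' + y') = - y + (- x + x' + y) + (- y + y').
  by rewrite sboppD -!sbaddA sbaddNK.
by apply: ideal_addD; [apply: ideal_addJ|]; exact: quot_repr.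
Qed.

Lemma pi_quot_mul : {morph \pi_quot : x y / x ∘ y >-> quot_mul x y}.
Proof.
move=> x y; unlock quot_mul; apply/quot_eqP.
set x' := repr _; set y' := repr _.
apply/asboolP/ideal_eqM.
have -> : (x ∘ y)^-1%g ∘ (x' ∘ y') =
    y^-1%g ∘ (x^-1%g ∘ x' ∘ y) ∘ (y^-1%g ∘ y').
  by rewrite invgM !mulgA mulgK.
apply: ideal_mulM; [apply: ideal_mulJ|];
  by apply/ideal_eqM/asboolP; exact: quot_repr.
Qed.

Lemma pi_quot_opp : {morph \pi_quot : x / - x >-> quot_opp x}.
Proof.
move=> x; unlock quot_opp; apply/quot_eqP; set x' := repr _.
have -> : - - x - x' = - (- (- x) + (- x + x' - x)).
  by rewrite sboppK -!sbaddA sbaddNK sboppD sboppK.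
by apply: ideal_addN; apply: ideal_addJ; exact: quot_repr.
Qed.

Lemma pi_quot_inv : {morph \pi_quot : x / x^-1%g >-> quot_inv x}.
Proof.
move=> x; unlock quot_inv; apply/quot_eqP; set x' := repr _.
apply/asboolP/ideal_eqM.
have -> : x^-1%g^-1%g ∘ x'^-1%g = (x^-1%g^-1%g ∘ (x^-1%g ∘ x' ∘ x^-1%g))^-1%g.
  by rewrite !invgM !invgK !mulgA mulgK.
apply: ideal_mulV; apply: ideal_mulJ.
by apply/ideal_eqM/asboolP; exact: quot_repr.
Qed.

Lemma quot_mulA : associative quot_mul.
Proof.
elim/quotW=> x; elim/quotW=> y; elim/quotW=> z.
by rewrite -!pi_quot_mul mulgA.
Qed.

Lemma quot_mul1 : left_id quot_zero quot_mul.
Proof. by elim/quotW=> x; rewrite -pi_quot_mul -sb10 mul1g. Qed.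

Lemma quot_mulr1 : right_id quot_zero quot_mul.
Proof. by elim/quotW=> x; rewrite -pi_quot_mul -sb10 mulg1. Qed.

Lemma quot_mulV : left_inverse quot_zero quot_inv quot_mul.
Proof. by elim/quotW=> x; rewrite -pi_quot_inv -pi_quot_mul mulVg sb10. Qed.

Lemma quot_mulrV : right_inverse quot_zero quot_inv quot_mul.
Proof. by elim/quotW=> x; rewrite -pi_quot_inv -pi_quot_mul mulgV sb10. Qed.

HB.instance Definition _ :=
  isGroup.Build quot quot_mulA quot_mul1 quot_mulr1 quot_mulV quot_mulrV.

Lemma quot_addA : associative quot_add.
Proof.
elim/quotW=> x; elim/quotW=> y; elim/quotW=> z.
by rewrite -!pi_quot_add sbaddA.
Qed.

Lemma quot_add0 : left_id quot_zero quot_add.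
Proof. by elim/quotW=> x; rewrite -pi_quot_add sbadd0. Qed.

Lemma quot_addr0 : right_id quot_zero quot_add.
Proof. by elim/quotW=> x; rewrite -pi_quot_add sbaddr0. Qed.

Lemma quot_addN : left_inverse quot_zero quot_opp quot_add.
Proof. by elim/quotW=> x; rewrite -pi_quot_opp -pi_quot_add sbaddN. Qed.

Lemma quot_addrN : right_inverse quot_zero quot_opp quot_add.
Proof. by elim/quotW=> x; rewrite -pi_quot_opp -pi_quot_add sbaddrN. Qed.

Lemma quot_mulD (a b c : quot) :
  mul a (quot_add b c) = quot_add (quot_add (mul a b) (quot_opp a)) (mul a c).
Proof.
elim/quotW: a => a; elim/quotW: b => b; elim/quotW: c => c.
rewrite /mul /= -pi_quot_opp -!(pi_quot_add, pi_quot_mul).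
by rewrite sbmulD.
Qed.

HB.instance Definition _ := Group_isSkewBrace.Build quot
  quot_addA quot_add0 quot_addr0 quot_addN quot_addrN quot_mulD.

End Quotient.

Section AnnihilatorSeries.
Variable B : skewBraceType.

(* Only the terms of index at most n matter. The image of [I j.+1] by the
   projection onto [quot (I j)] is I_{j+1}/I_j. *)
Definition annihilator_series (n : nat) (I : nat -> ideal B) : Prop :=
  [/\ ideal_set (I 0%N) = [set 0], ideal_set (I n) = setT
    & forall j, (j < n)%N ->
        ideal_set (I j) `<=` ideal_set (I j.+1) /\
        \pi_(quot (I j)) @` I j.+1 `<=` annihilator (quot (I j))].

Definition annihilator_nilpotent : Prop :=
  exists n I, annihilator_series n I.

End AnnihilatorSeries.

(* Main.v *)
Require Import Defs.
From HB Require Import structures.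
From mathcomp Require Import all_boot.
From mathcomp Require Import boolp classical_sets.

(** Annihilator nilpotency is membership of B in the upper annihilator series
Z_n, where x lies in Z_{n+1} if and only if x * a, a * x and the additive
commutator of x and a lie in Z_n for all a. Let L_j, R_k and C_i be the left
series, the right series and the lower central series of (B, +). If x is in
R_k, C_i and L_j, then
- x * a is in R_{k+1},
- the additive commutator of x and a is in R_k and C_{i+1},
- a * x is in R_k, C_i and L_{j+1}.
Hence, if the three series reach 0, a descending lexicographic induction on
(k, i, j) puts each of these intersections, and finally B, in some Z_n.
Conversely, each star with an element of an annihilator series goes down one
step; since one of the indices in B^{[i]} * B^{[m-i]} is at least m/2, the
series reaches 0 no later than the index 2^n. *)

Set Implicit Arguments.
Unset Strict Implicit.
Unset Printing Implicit Defensive.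

Local Open Scope classical_set_scope.
Local Open Scope quotient_scope.
Local Open Scope skew_scope.

(** * Generated subgroups and the lower central series *)

Section GeneratedSubgroups.
Local Open Scope group_scope.
Variable G : groupType.
Implicit Types (H X Y : set G) (f : G -> G).

Lemma subgroup_generated X : subgroup (generated X).
Proof.
split=> [H [[]]//|x y gx gy H HX|x gx H HX].
  by case: (HX) => -[_ + _] _; apply; [exact: gx|exact: gy].
by case: (HX) => -[_ _ +] _; apply; exact: gx.
Qed.

Lemma sub_generated X : X `<=` generated X.
Proof. by move=> x Xx H [_]; apply. Qed.

Lemma generated_sub X H : subgroup H -> X `<=` H -> generated X `<=` H.
Proof. by move=> sH XH x; apply. Qed.

Lemma generatedS X Y : X `<=` Y -> generated X `<=` generated Y.
Proof.
move=> XY; apply: generated_sub; first exact: subgroup_generated.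
by move=> x /XY; exact: sub_generated.
Qed.

Lemma subgroup_preimage f H :
  {morph f : x y / x * y} -> subgroup H -> subgroup (f @^-1` H).
Proof.
move=> fM [H1 HM HV].
have f1 : f 1 = 1 by apply: (mulgI (f 1)); rewrite -fM !mulg1.
split=> [|x y|x]; rewrite /preimage /= ?f1 ?fM //; first exact: HM.
suff -> : f x^-1 = (f x)^-1 by exact: HV.
by apply: (mulgI (f x)); rewrite -fM !mulgV.
Qed.

(** Endomorphisms map commutators to commutators. The case [f := lambda a] on (B, +) is what keeps
    [star a x] in the lower central term of [x]. *)
Lemma lower_central_endo f n x :
  {morph f : x y / x * y} -> lower_central n x -> lower_central n (f x).
Proof.
move=> fM; elim: n x => [//|n IHn]; apply: generated_sub.
  by apply: subgroup_preimage => //; exact: subgroup_generated.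
move=> _ [x nx [y _ <-]]; apply: sub_generated.
exists (f x); first exact: IHn.
exists (f y) => //; rewrite /commg /conjg !fM.
have f1 : f 1 = 1 by apply: (mulgI (f 1)); rewrite -fM !mulg1.
have fV z : f z^-1 = (f z)^-1.
  by apply: (mulgI (f z)); rewrite -fM !mulgV.
by rewrite !fV.
Qed.

End GeneratedSubgroups.

(** * Identities for [lambda] and [star], ideals, and the annihilator *)

Section SkewBraceTheory.
Variable B : skewBraceType.
Implicit Types (a b c x y : B) (I X Y : set B).

Lemma sbaddKN a b : - a + (a + b) = b.
Proof. by rewrite sbaddA sbaddN sbadd0. Qed.

Lemma sbaddrI a : injective (sbadd a).
Proof. exact: (@mulgI (addgroup B)). Qed.

Lemma sboppr0 : - 0 = 0 :> B.
Proof. by rewrite -[LHS]sbadd0 sbaddrN. Qed.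

Lemma sbsub_eq0 a b : a - b = 0 -> a = b.
Proof. by move=> h; rewrite -[a]sbaddr0 -(sbaddN b) sbaddA h sbadd0. Qed.

Lemma mul_lambda a b : a ∘ b = a + lambda a b.
Proof. by rewrite sbaddNK. Qed.

Lemma lambdaD a : {morph lambda a : b c / b + c}.
Proof. by move=> b c; rewrite /lambda sbmulD !sbaddA. Qed.

Lemma lambda0 a : lambda a 0 = 0.
Proof. by apply: (sbaddrI (a := lambda a 0)); rewrite -lambdaD !sbaddr0. Qed.

Lemma lambdaN a b : lambda a (- b) = - lambda a b.
Proof.
by apply: (sbaddrI (a := lambda a b)); rewrite -lambdaD !sbaddrN lambda0.
Qed.

Lemma lambdaM a b c : lambda (a ∘ b) c = lambda a (lambda b c).
Proof.
have -> : lambda b c = - b + b ∘ c by [].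
by rewrite lambdaD lambdaN /lambda sboppD sboppK -!sbaddA sbaddNK mulgA.
Qed.

Lemma lambda1 b : lambda 0 b = b.
Proof. by rewrite /lambda -{2}sb10 mul1g sboppr0 sbadd0. Qed.

Lemma lambdaVr a : lambda a a^-1%g = - a.
Proof. by rewrite /lambda mulgV sb10 sbaddr0. Qed.

Lemma lambda_star a b : lambda a b = star a b + b.
Proof. by rewrite /star -[RHS]sbaddA sbaddN sbaddr0. Qed.

Lemma starD a b c : star a (b + c) = star a b + (b + star a c - b).
Proof.
by rewrite /star -!/(lambda _ _) lambdaD sboppD -!sbaddA sbaddKN.
Qed.

Lemma star0r a : star 0 a = 0.
Proof. by rewrite /star -/(lambda 0 a) lambda1 sbaddrN. Qed.

Lemma starr0 a : star a 0 = 0.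
Proof. by rewrite /star -/(lambda a 0) lambda0 sbaddrN. Qed.

Lemma star_mulV x a :
  star x a = - x + (a + lambda a (a^-1%g ∘ (x ∘ a)) - a).
Proof. by rewrite -(mul_lambda a) mulVKg /star sbaddA. Qed.

(** Since [lambda] is an action of (B, ∘), moving [lambda a] past [lambda x] conjugates [x] by [a]
    in (B, ∘). This makes [star_set I setT] stable under [lambda] when [I] is an ideal. *)
Lemma lambda_starJ a x y :
  lambda a (star x y) = star (a ∘ x ∘ a^-1%g) (lambda a y).
Proof.
rewrite [in LHS]/star -/(lambda x y) [in RHS]/star -/(lambda _ (lambda a y)).
by rewrite lambdaD lambdaN -!lambdaM -!mulgA mulVg mulg1.
Qed.

Lemma mulJ_star a x :
  a ∘ x ∘ a^-1%g = a + (lambda a x + lambda a (star x a^-1%g)) - a.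
Proof.
rewrite -mulgA !mul_lambda lambdaD (lambda_star x) lambdaD lambdaVr.
by rewrite !sbaddA.
Qed.

(** Normality in (B, ∘) is traded for [I (star x a)]: [star_mulV] writes [star x a] through a
    ∘-conjugate of [x], and [mulJ_star] writes a ∘-conjugate through [lambda] and [star]. No
    ∘-conjugate has to be handled in the later ideal proofs that establish these four closures. *)
Lemma is_idealP I :
  is_ideal I <->
  [/\ subgroup (I : set (addgroup B)),
      forall a x, I x -> I (a + x - a),
      forall a x, I x -> I (lambda a x)
    & forall a x, I x -> I (star x a)].
Proof.
split=> [idI|[sI Ij Il Is]].
  pose J := Ideal idI; split=> [|a x Ix|a x|a x Ix].
  - by have [[]] := idI.
  - by have := @ideal_addJ _ J x (- a) Ix; rewrite sboppK sbaddA.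
  - exact: (@ideal_lambda _ J).
  - rewrite star_mulV; apply: (@ideal_addD _ J).
      exact: (@ideal_addN _ J).
    rewrite -(sboppK a) -sbaddA sboppK -{2}(sboppK a).
    have := @ideal_addJ _ J (lambda a (a^-1%g ∘ (x ∘ a))) (- a).
    rewrite sboppK; apply; apply: (@ideal_lambda _ J).
    exact: (@ideal_mulJ _ J).
have [I0 ID IN] := sI; split=> //.
- split=> // x a Ix; have := Ij (- a) x Ix.
  by rewrite sboppK -sbaddA.
- split.
    split=> [|x y Ix Iy|x Ix].
    + by rewrite sb10.
    + by rewrite mul_lambda; apply: ID => //; exact: Il.
    + have -> : x^-1%g = - lambda x^-1%g x.
        by rewrite /lambda mulVg sb10 sbaddr0 sboppK.
      by apply: IN; exact: Il.
  move=> x a Ix; have := mulJ_star a^-1%g x.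
  rewrite invgK /conjg mulgA => ->.
  by apply: Ij; apply: ID; apply: Il => //; exact: Is.
Qed.

Lemma star_setS X X' Y Y' :
  X `<=` X' -> Y `<=` Y' -> star_set X Y `<=` star_set X' Y'.
Proof.
move=> XX' YY'; apply: (@generatedS (addgroup B)).
move=> _ [x /XX' X'x [y /YY' Y'y <-]].
by exists x => //; exists y.
Qed.

Lemma sub_star_set X Y x y : X x -> Y y -> star_set X Y (star x y).
Proof.
move=> Xx Yy; apply: (@sub_generated (addgroup B)).
by exists x => //; exists y.
Qed.

Lemma ideal_star_setT I : is_ideal I -> is_ideal (star_set I setT).
Proof.
move=> idI; have [sI Ij Il Is] := (is_idealP I).1 idI.
have [s0 sD sN] : subgroup (star_set I setT : set (addgroup B)).
  exact: subgroup_generated.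
have subI : star_set I setT `<=` I.
  by apply: (@generated_sub (addgroup B)) => // _ [x Ix [y _ <-]]; exact: Is.
apply/is_idealP; split=> // a.
- apply: (generated_sub (G := addgroup B)
    (H := (fun x => a + x - a) @^-1` star_set I setT)).
    apply: (@subgroup_preimage (addgroup B) (fun x => a + x - a)); last by [].
    move=> x y.
    by rewrite /mul /= -!sbaddA sbaddKN.
  move=> _ [x Ix [y _ <-]]; rewrite /preimage /=.
  (* Solving [starD] for the additive conjugate turns it into generators; the right factor may be
     any element because it ranges over [setT]. *)
  have -> : a + star x y - a = - star x a + star x (a + y).
    by rewrite starD sbaddKN.
  by apply: sD; [apply: sN|]; exact: sub_star_set.
- apply: (generated_sub (G := addgroup B)
    (H := lambda a @^-1` star_set I setT)).
    by apply: (@subgroup_preimage (addgroup B) (lambda a)) => //; exact: lambdaD.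
  move=> _ [x Ix [y _ <-]]; rewrite /preimage /= lambda_starJ.
  (* The new left factor is a ∘-conjugate of [x], hence still in the ideal [I]. *)
  apply: sub_star_set => //.
  have := @ideal_mulJ _ (Ideal idI) x a^-1%g Ix.
  by rewrite invgK mulgA.
- by move=> x /subI Ix; exact: sub_star_set.
Qed.

Lemma ideal_setT : is_ideal [set: B].
Proof. by []. Qed.

Lemma ideal_set0 : is_ideal [set 0 : B].
Proof.
apply/is_idealP; split=> [|a x ->|a x ->|a x ->].
- split=> [//|x y -> ->|x ->]; first exact: sbadd0.
  exact: sboppr0.
- by rewrite /= sbaddr0 sbaddrN.
- by rewrite /= lambda0.
- by rewrite /= star0r.
Qed.

Lemma ideal_right_series n : is_ideal (right_series B n).
Proof.
by elim: n => [|n IHn]; [exact: ideal_setT|exact: ideal_star_setT].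
Qed.

Lemma annihilatorP x :
  annihilator B x <->
  forall a, [/\ star x a = 0, star a x = 0 & x + a = a + x].
Proof.
split=> h a.
  have [e1 e2 e3] := h a; rewrite /star e1 e2; split=> //.
    by rewrite sbaddKN sbaddrN.
  by rewrite e3 sbaddKN sbaddrN.
have [+ + e3] := h a; rewrite /star -!/(lambda _ _).
move=> /sbsub_eq0 e1 /sbsub_eq0 e2.
by split=> //; rewrite !mul_lambda ?e1 ?e2 e3.
Qed.

(** On annihilator elements the two operations agree, so sums and opposites can be computed in (B,
    ∘). Additive conjugation and [lambda] fix such elements, and [star x a] vanishes. *)
Lemma ideal_annihilator : is_ideal (annihilator B).
Proof.
have annD x y : annihilator B x -> annihilator B y -> annihilator B (x + y).
  move=> hx hy a.
  have xyE : x + y = x ∘ y by have [-> -> _] := hx y.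
  have [x1 x2 x3] := hx a; have [y1 y2 y3] := hy a.
  have ay : a ∘ (x + y) = a + (x + y).
    rewrite xyE mulgA x2 x3.
    by have [_ -> ->] := hy (a + x); rewrite -xyE sbaddA.
  have c : x + y + a = a + (x + y).
    by rewrite -sbaddA y3 sbaddA x3 -sbaddA.
  split=> //; last by rewrite ay c.
  by rewrite xyE -mulgA y1 mulgA x1 mulgA.
have annN x : annihilator B x -> annihilator B (- x).
  move=> hx a.
  have VE : - x = x^-1%g.
    have [e1 e2 _] := hx x^-1%g.
    by apply: (sbaddrI (a := x)); rewrite sbaddrN -e2 mulVg sb10.
  have comm : x^-1%g ∘ a = a ∘ x^-1%g.
    by have [e _ _] := hx a; apply: (mulgI x); rewrite mulVKg mulgA e mulgK.
  have sE : a ∘ x^-1%g = a - x.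
    have [e1 e2 e3] := hx (a - x).
    by apply: (mulIg x); rewrite mulgVK e2 e3 -sbaddA sbaddN sbaddr0.
  have cE : - x + a = a - x.
    have [_ _ e] := hx a.
    by apply: (sbaddrI (a := x)); rewrite sbaddNK sbaddA e -sbaddA sbaddrN
      sbaddr0.
  by split=> //; [rewrite VE|rewrite cE VE sE VE].
have ann0 : annihilator B 0.
  by apply/annihilatorP=> a; rewrite star0r starr0 sbadd0 sbaddr0.
apply/is_idealP; split=> //.
- move=> a x hx; have [_ _ e] := hx a.
  by rewrite -e -sbaddA sbaddrN sbaddr0.
- move=> a x hx; have [_ e1 e2] := hx a.
  by rewrite /lambda e1 e2 sbaddKN.
- move=> a x /annihilatorP/(_ a)[-> _ _].
  exact: ann0.
Qed.

End SkewBraceTheory.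

(** * Preimage in B of the annihilator of a quotient *)

Section AnnihilatorPreimage.
Variables (B : skewBraceType) (J : ideal B).
Local Notation pi := \pi_(quot J).
Local Notation I := (ideal_set J).

Lemma pi_quot_star : {morph pi : x y / star x y}.
Proof.
by move=> x y; rewrite /star !pi_quot_add pi_quot_mul !pi_quot_opp.
Qed.

Lemma pi_quot_eq0 x : pi x = 0 <-> I x.
Proof.
split=> [/esym/quot_eqP|Jx].
  by rewrite sboppr0 sbadd0.
by apply/esym/quot_eqP; rewrite sboppr0 sbadd0.
Qed.

Definition annihilator_preimage : set B := pi @^-1` annihilator (quot J).

Lemma ideal_annihilator_preimage : is_ideal annihilator_preimage.
Proof.
have [[A0 AD AN] Aj Al As] := (is_idealP _).1 (ideal_annihilator (quot J)).
apply/is_idealP; rewrite /annihilator_preimage /preimage /=; split.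
- split=> [|x y Ax Ay|x Ax] /=.
  + exact: A0.
  + by rewrite pi_quot_add; exact: AD.
  + by rewrite pi_quot_opp; exact: AN.
- by move=> a x Ax; rewrite !pi_quot_add pi_quot_opp; exact: Aj.
- move=> a x Ax; rewrite /lambda pi_quot_add pi_quot_opp pi_quot_mul.
  exact: Al.
- by move=> a x Ax; rewrite pi_quot_star; exact: As.
Qed.

Lemma annihilator_preimageP x :
  annihilator_preimage x <->
  forall a, [/\ I (star x a), I (star a x) & I (- x + (- a + (x + a)))].
Proof.
(* The cosets of [a + x] and [x + a] agree when [- (a + x) + (x + a)], the additive commutator, lies
   in [I]. *)
have commE a : pi x + pi a = pi a + pi x <-> I (- x + (- a + (x + a))).
  have piD : {morph pi : x y / x + y} := @pi_quot_add _ J.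
  rewrite -!piD; split=> [/esym/quot_eqP|h].
    by rewrite sboppD -!sbaddA.
  by apply/esym/quot_eqP; rewrite sboppD -!sbaddA.
split=> [/annihilatorP h a|h].
  have [] := h (pi a); rewrite -!pi_quot_star.
  by move=> /pi_quot_eq0 ? /pi_quot_eq0 ? /commE.
apply/annihilatorP; elim/quotW=> a; rewrite -!pi_quot_star.
by have [/pi_quot_eq0 ? /pi_quot_eq0 ? /commE] := h a.
Qed.

Lemma sub_annihilator_preimage : I `<=` annihilator_preimage.
Proof.
have [_ _ Jl Js] := (is_idealP _).1 (idealP J).
move=> x Jx; apply/annihilator_preimageP=> a; split.
- exact: Js.
- by rewrite /star; apply: ideal_addD; [exact: Jl|exact: ideal_addN].
- by apply: ideal_addD; [exact: ideal_addN|exact: ideal_addJ].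
Qed.

End AnnihilatorPreimage.

(** * The upper annihilator series *)

Section NilpotencyConditions.
Variable B : skewBraceType.

Fixpoint upper_annihilator (n : nat) : ideal B :=
  if n is m.+1
  then Ideal (ideal_annihilator_preimage (upper_annihilator m))
  else Ideal (ideal_set0 B).

Local Notation Z n := (ideal_set (upper_annihilator n)).

Lemma upper_annihilatorS n x :
  Z n.+1 x <->
  forall a, [/\ Z n (star x a), Z n (star a x)
    & Z n (- x + (- a + (x + a)))].
Proof. exact: annihilator_preimageP. Qed.

Lemma upper_annihilator_le m n :
  (m <= n)%N -> Z m `<=` Z n.
Proof.
elim: n => [|n IHn]; first by rewrite leqn0 => /eqP->.
rewrite leq_eqVlt => /predU1P[->//|/IHn h x /h].
exact: sub_annihilator_preimage.
Qed.

(** The [Z j] themselves form the series: [Z j.+1] is by construction the preimage of the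
    annihilator of B/[Z j], so only reaching B is in question. *)
Lemma upper_annihilator_nilpotent n :
  Z n = setT :> set B -> annihilator_nilpotent B.
Proof.
move=> nT; exists n, upper_annihilator; split=> // j _; split.
  exact: sub_annihilator_preimage.
by move=> _ [x + <-].
Qed.

Lemma descending_ind (P : nat -> Prop) n :
  P n -> (forall k, P k.+1 -> P k) -> P 0%N.
Proof. by move=> Pn PS; elim: n Pn => // n IHn /PS. Qed.

(** * Effect of [star] and commutators on the three descending series *)

Lemma right_star p x a : right_series B p x -> right_series B p.+1 (star x a).
Proof. by move=> Rx; exact: sub_star_set. Qed.

Lemma right_left_star p x a : right_series B p x -> right_series B p (star a x).
Proof.
have [[_ ID IN] _ Il _] := (is_idealP _).1 (ideal_right_series B p).
by move=> Rx; apply: ID; [exact: Il|exact: IN].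
Qed.

Lemma left_star s x a : left_series B s x -> left_series B s.+1 (star a x).
Proof. by move=> Lx; exact: sub_star_set. Qed.

(** [star a x] is [lambda a x - x], and [lambda a] is an additive endomorphism. *)
Lemma lower_central_star q x a :
  lower_central (G := addgroup B) q x ->
  lower_central (G := addgroup B) q (star a x).
Proof.
have [_ CD CN] : subgroup (lower_central (G := addgroup B) q).
  by case: q => [//|q]; exact: subgroup_generated.
move=> Cx; apply: CD; last exact: CN.
by apply: (@lower_central_endo (addgroup B) (lambda a)) => //; exact: lambdaD.
Qed.

Lemma right_commutator p x a :
  right_series B p x -> right_series B p (- x + (- a + (x + a))).
Proof.
move=> Rx; pose J := Ideal (ideal_right_series B p).
by apply: (@ideal_addD _ J); [exact: ideal_addN|exact: ideal_addJ].
Qed.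

Lemma lower_central_commutator q x a :
  lower_central (G := addgroup B) q x ->
  lower_central (G := addgroup B) q.+1 (- x + (- a + (x + a))).
Proof.
move=> Cx; apply: (@sub_generated (addgroup B)).
by exists x => //; exists a.
Qed.

Lemma left_right_annihilator_nilpotent :
  nilpotent_type B -> left_nilpotent B -> right_nilpotent B ->
  annihilator_nilpotent B.
Proof.
move=> [c Cc] [l Ll] [r Rr].
have Z0 n : Z n 0 by exact: ideal_add0.
pose R p q s : set B :=
  right_series B p `&` lower_central (G := addgroup B) q `&` left_series B s.
(* All three series start with the whole of B, so [R 0 0 0] is B. *)
suff [n Rn] : exists n, R 0%N 0%N 0%N `<=` Z n.
  by apply: (@upper_annihilator_nilpotent n); apply/seteqP; split=> // x _;
    exact: Rn.
apply: (@descending_ind (fun p => exists n, R p 0%N 0%N `<=` Z n) r)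
    => [|p [n Rn]].
  by exists 0%N => x [[]]; rewrite Rr => ->.
apply: (@descending_ind (fun q => exists n, R p q 0%N `<=` Z n) c)
    => [|q [n' Rn']].
  by exists 0%N => x [[_]]; rewrite Cc => ->.
apply: (@descending_ind (fun s => exists n, R p q s `<=` Z n) l)
    => [|s [n'' Rn'']].
  by exists 0%N => x [_]; rewrite Ll => ->.
(* The bounds [n], [n'], [n''] serve [R p.+1 0 0], [R p q.+1 0] and [R p q s.+1]: an increase of one
   index resets the later ones to 0, where membership is trivial. *)
pose m := maxn n (maxn n' n'').
have le_m : [/\ (n <= m)%N, (n' <= m)%N & (n'' <= m)%N].
  by rewrite /m !leq_max !leqnn !orbT.
exists m.+1 => x [[Rx Cx] Lx]; apply/upper_annihilatorS=> a.
have [lenm len'm len''m] := le_m; split.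
- by apply: (upper_annihilator_le lenm); apply: Rn; split=> //; split=> //;
    exact: right_star.
- apply: (upper_annihilator_le len''m); apply: Rn''; split.
    by split; [exact: right_left_star|exact: lower_central_star].
  exact: left_star.
- apply: (upper_annihilator_le len'm); apply: Rn'; split=> //.
  by split; [exact: right_commutator|exact: lower_central_commutator].
Qed.

(** * From an annihilator series to strong nilpotency *)

Lemma annihilator_series_star n (I : nat -> ideal B) j x a :
  annihilator_series n I -> (j < n)%N -> ideal_set (I j.+1) x ->
  ideal_set (I j) (star x a) /\ ideal_set (I j) (star a x).
Proof.
move=> [_ _ hI] /hI[_ subA] Ix.
have /annihilator_preimageP/(_ a)[] // : annihilator_preimage (I j) x.
by apply: subA; exists x.
Qed.

Lemma strong_series_sub_annihilator n (I : nat -> ideal B) k m :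
  annihilator_series n I -> (k <= n)%N -> (2 ^ k <= m.+1)%N ->
  strong_series B m `<=` I (n - k)%N.
Proof.
move=> annI; elim: k m => [|k IHk] m kn.
  by have [_ In _] := annI; rewrite subn0 In.
have step := annihilator_series_star (j := (n - k.+1)%N) _ annI.
have ltn : (n - k.+1 < n)%N by rewrite ltn_subrL (leq_trans _ kn).
case: m => [|m].
  (* Index 0 cannot occur: it would require [2 ^ k.+1 <= 1]. *)
  by rewrite expnS leqNgt (@leq_trans 2) // leq_pmulr ?expn_gt0.
move=> le_m; rewrite strong_seriesS.
have [[sI _] _ _] := idealP (I (n - k.+1)%N).
apply: (@generated_sub (addgroup B)) => // y [i /= ltim].
apply: (@generated_sub (addgroup B)) => // _ [x hx [z hz <-]].
(* With the shifted indexing, [i.+1] and [(m - i).+1] add up to [m.+2], which is at least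
   [2 ^ k.+1]. So one of them reaches [2 ^ k], and induction applies to that factor. *)
have [lei|gti] := leqP (2 ^ k) i.+1.
  have /(step _ z ltn)[] // : ideal_set (I (n - k.+1).+1) x.
  by rewrite -subSn // subSS; apply: IHk hx => //; exact: ltnW.
have /(step _ x ltn)[] // : ideal_set (I (n - k.+1).+1) z.
rewrite -subSn // subSS; apply: IHk hz; first exact: ltnW.
rewrite -(leq_add2r i.+1) (@leq_trans (2 ^ k.+1)) //.
  by rewrite expnS mul2n -addnn leq_add2l ltnW.
by rewrite addSn addnS subnK.
Qed.

Lemma strong_series_0 n : strong_series B n 0.
Proof.
by case: n => [//|n]; rewrite strong_seriesS => H [[]].
Qed.

Lemma annihilator_strongly_nilpotent :
  annihilator_nilpotent B -> strongly_nilpotent B.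
Proof.
move=> [n [I annI]]; exists (2 ^ n)%N; apply/seteqP; split=> [x|_ ->].
  have [I0 _ _] := annI.
  have /(_ x) := strong_series_sub_annihilator (m := (2 ^ n)%N) annI
    (leqnn n) (leqnSn _).
  by rewrite subnn I0.
exact: strong_series_0.
Qed.

(** * Left and right series inside the strong series *)

Lemma left_series_sub_strong n : left_series B n `<=` strong_series B n.
Proof.
elim: n => [//|n IHn]; rewrite strong_seriesS.
(* The summand at 0 has B itself as left factor, matching the recursion of the left series. *)
apply: (@generatedS (addgroup B)) => y hy; exists 0%N => //=.
rewrite subn0; apply: (star_setS _ IHn (X := setT)) => //.
exact: sub_generated.
Qed.

Lemma right_series_sub_strong n : right_series B n `<=` strong_series B n.
Proof.
elim: n => [//|n IHn]; rewrite strong_seriesS.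
(* The last summand has B itself as right factor, since [n - n] is 0. *)
apply: (@generatedS (addgroup B)) => y hy; exists n => //=.
rewrite subnn; apply: (star_setS IHn (Y := setT)) => //.
exact: sub_generated.
Qed.

Lemma strongly_left_right_nilpotent :
  strongly_nilpotent B -> left_nilpotent B /\ right_nilpotent B.
Proof.
move=> [n Sn]; split; exists n; apply/seteqP; split=> [x|_ ->].
- by move=> /left_series_sub_strong; rewrite Sn.
- by case: (n) => [//|m] H [[]].
- by move=> /right_series_sub_strong; rewrite Sn.
- by case: (n) => [//|m] H [[]].
Qed.

End NilpotencyConditions.

Theorem corollary2p15 (B : skewBraceType) (hB : nilpotent_type B) :
  [<-> annihilator_nilpotent B;
       left_nilpotent B /\ right_nilpotent B;
       strongly_nilpotent B].
Proof.
tfae=> [annB|[lB rB]|sB].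
- exact/strongly_left_right_nilpotent/annihilator_strongly_nilpotent.
- exact/annihilator_strongly_nilpotent/left_right_annihilator_nilpotent.
- have [lB rB] := strongly_left_right_nilpotent sB.
  exact: left_right_annihilator_nilpotent.
Qed.
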